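(* Consider $\Phi\colon\ell^2(\mathbb{N};\mathbb{R})/\!/S_\infty\to\ell^2(\mathbb{N};\mathbb{R})$ defined by \[ \Phi([x])_n=\begin{cases}(x_+)_{(\frac{n}{2})}&\text{if $n$ is even}\\-(x_-)_{(\frac{n+1}{2})}&\text{if $n$ is odd.}\end{cases} \] Then $\|\Phi([x])-\Phi([y])\|_{\ell^2}=d_{\ell^2(\mathbb{N};\mathbb{R})/\!/S_\infty}([x],[y])$ for all $x,y\in\ell^2(\mathbb{N};\mathbb{R})$. Consequently, $c_2(\ell^2(\mathbb{N};\mathbb{R})/\!/S_\infty)=1$.
   Context: $\mathbb{N}=\{1,2,\ldots\}$; $\ell^2(\mathbb{N};\mathbb{R})$ is the Hilbert space of square summable real sequences, and $S_\infty$ is the group of all bijections $\mathbb{N}\to\mathbb{N}$, acting by permuting the index set. The metric quotient $\ell^2(\mathbb{N};\mathbb{R})/\!/S_\infty$ has as points the closures $[x]=\overline{S_\infty\cdot x}$ of orbits, with metric $d([x],[y])=\inf\{\|p-q\|_{\ell^2}:p\in S_\infty\cdot x,\ q\in S_\infty\cdot y\}$. For $x\in\ell^2(\mathbb{N};\mathbb{R})$, $x_+$ and $x_-$ are the entrywise positive and negative parts, so that $x_\pm$ are entrywise nonnegative and $x=x_+-x_-$. For entrywise nonnegative $z\in\ell^2(\mathbb{N};\mathbb{R})$, $z_{(n)}$ denotes its $n$th largest entry (counted with multiplicity, so $z_{(n)}=0$ if $z$ has fewer than $n$ positive entries). The Euclidean distortion $c_2(X)\in[1,\infty]$ of a metric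 space $X$ is the infimum of all $c$ for which there exist a Hilbert space $H$, a map $f\colon X\to H$ and a constant $\alpha>0$ such that $\alpha\, d_X(x,x')\leq\|f(x)-f(x')\|\leq c\,\alpha\, d_X(x,x')$ for all $x,x'\in X$. *)

(* Defs.v *)
(* MathComp-Analysis *)
From HB Require Import structures.
From mathcomp Require Import all_boot all_order all_algebra.
From mathcomp Require Import sesquilinear.
From mathcomp Require Import all_classical all_reals all_analysis.
From mathcomp Require Import ring lra.

Set Implicit Arguments.
Unset Strict Implicit.
Unset Printing Implicit Defensive.

Import Order.TTheory GRing.Theory Num.Theory.
Import numFieldNormedType.Exports.

Local Open Scope classical_set_scope.
Local Open Scope ring_scope.

(* Sequences indexed by {1, 2, ...} are encoded as functions on nat, with      *)
(* x k standing for the (k+1)-st entry.                                        *)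

Section square_summable.
Context {R : realType}.
Implicit Types x y z : nat -> R.

Definition sqseries x : nat -> R := series (fun k => x k ^+ 2).

Definition square_summable : {pred nat -> R} :=
  [pred x : nat -> R | `[< cvgn (sqseries x) >]].

Definition ell2_norm x : R := Num.sqrt (limn (sqseries x)).

Lemma square_summableP x : reflect (cvgn (sqseries x)) (x \in square_summable).
Proof. exact: asboolP. Qed.

Lemma sqseries_nd x : nondecreasing_seq (sqseries x).
Proof.
apply/nondecreasing_seqP => n.
by rewrite /sqseries /series /= big_nat_recr//= lerDl sqr_ge0.
Qed.

Lemma sqseries_ge0 x n : 0 <= sqseries x n.
Proof. by apply: sumr_ge0 => i _; exact: sqr_ge0. Qed.

Lemma sqseries_le_lim x n :
  x \in square_summable -> sqseries x n <= limn (sqseries x).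
Proof.
by move=> /square_summableP cx; exact: (nondecreasing_cvgn_le (@sqseries_nd x)).
Qed.

Lemma sqseries_lim_ge0 x : 0 <= limn (sqseries x).
Proof.
have [cx|ncx] := pselect (cvgn (sqseries x)).
  by apply: le_trans (sqseries_le_lim 0 _); [exact: sqseries_ge0 | exact/asboolP].
by rewrite (dvgP ncx).
Qed.

Lemma ell2_norm_sqr x : ell2_norm x ^+ 2 = limn (sqseries x).
Proof. by rewrite sqr_sqrtr// sqseries_lim_ge0. Qed.

Lemma bounded_square_summable x (M : R) :
  (forall n, sqseries x n <= M) -> x \in square_summable.
Proof.
move=> xM; apply/square_summableP.
apply: (nondecreasing_is_cvgn (@sqseries_nd x)).
by exists M => _ [n _ <-]; exact: xM.
Qed.

Lemma ell2_norm_le x (M : R) : 0 <= M ->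
  (forall n, sqseries x n <= M ^+ 2) -> ell2_norm x <= M.
Proof.
move=> M0 xM; rewrite -(@ler_pXn2r _ 2)// ?nnegrE ?sqrtr_ge0//.
rewrite ell2_norm_sqr; apply: limr_le => //.
  exact/square_summableP/(bounded_square_summable xM).
exact: nearW.
Qed.

Lemma square_summable_submod : submod_closed square_summable.
Proof.
split.
  apply: (@bounded_square_summable _ 0) => n.
  by rewrite /sqseries /series /= big1// => i _; rewrite expr0n.
move=> a x y sx sy.
apply: (@bounded_square_summable _
  (2 * a ^+ 2 * limn (sqseries x) + 2 * limn (sqseries y))) => n.
apply: (@le_trans _ _ (2 * a ^+ 2 * sqseries x n + 2 * sqseries y n)).
  rewrite /sqseries /series /= !mulr_sumr -big_split/=.
  apply: ler_sum => i _.
  rewrite !fctE.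
  have := sqr_ge0 (a * x i - y i); rewrite /GRing.scale/=; nra.
apply: lerD; apply: ler_wpM2l => //; rewrite ?sqseries_le_lim//.
by rewrite mulr_ge0// sqr_ge0.
Qed.

HB.instance Definition _ :=
  GRing.isSubmodClosed.Build _ _ square_summable square_summable_submod.

End square_summable.

Section ell2.
Variable R : realType.

Record ell2 := Ell2 {
  ell2_seq :> nat -> R;
  ell2P : ell2_seq \in square_summable
}.

HB.instance Definition _ := [isSub for ell2_seq].
HB.instance Definition _ := [Choice of ell2 by <:].
HB.instance Definition _ := [SubChoice_isSubLmodule of ell2 by <:].

Implicit Types x y : ell2.

Lemma ell2_eqP x y : (forall k, x k = y k) -> x = y.
Proof. by move=> xy; apply/val_inj/funext. Qed.

Lemma ell2B x y k : (x - y) k = x k - y k.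
Proof. by []. Qed.

Lemma ell2_norm0_eq0 x : ell2_norm x = 0 -> x = 0.
Proof.
move=> x0; apply: ell2_eqP => k.
apply/eqP; rewrite -sqrf_eq0.
rewrite eq_le sqr_ge0 andbT.
have := sqseries_le_lim k.+1 (ell2P x).
rewrite -ell2_norm_sqr x0 expr0n/= => /(le_trans _); apply.
by rewrite /sqseries /series /= big_nat_recr//= lerDr sqseries_ge0.
Qed.

Lemma ell2_norm_triangle x y :
  ell2_norm (x + y) <= ell2_norm x + ell2_norm y.
Proof.
have [->|x0] := eqVneq x 0; first by rewrite add0r lerDr sqrtr_ge0.
have [->|y0] := eqVneq y 0; first by rewrite addr0 lerDl sqrtr_ge0.
have nx : 0 < ell2_norm x.
  rewrite lt_neqAle sqrtr_ge0 andbT eq_sym.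
  by apply: contra x0 => /eqP /ell2_norm0_eq0 ->.
have ny : 0 < ell2_norm y.
  rewrite lt_neqAle sqrtr_ge0 andbT eq_sym.
  by apply: contra y0 => /eqP /ell2_norm0_eq0 ->.
set A := ell2_norm x in nx *; set B := ell2_norm y in ny *.
apply: ell2_norm_le; first by rewrite addr_ge0// ltW.
move=> n.
have xA : sqseries x n <= A ^+ 2 by rewrite ell2_norm_sqr sqseries_le_lim// ell2P.
have yB : sqseries y n <= B ^+ 2 by rewrite ell2_norm_sqr sqseries_le_lim// ell2P.
have E : A * B * sqseries (x + y) n <=
    (A + B) * (B * sqseries x n + A * sqseries y n).
  rewrite /sqseries /series /= !mulr_sumr -big_split/= mulr_sumr.
  apply: ler_sum => i _; rewrite !fctE.
  have := sqr_ge0 (B * x i - A * y i).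
  nra.
have AB : 0 < A * B by rewrite mulr_gt0.
rewrite -(ler_pM2l AB); apply: (le_trans E).
have -> : A * B * (A + B) ^+ 2 = (A + B) * (B * A ^+ 2 + A * B ^+ 2) by ring.
apply: ler_wpM2l; first by rewrite addr_ge0// ltW.
by apply: lerD; apply: ler_wpM2l => //; exact: ltW.
Qed.

Lemma ell2_normZ (a : R) x : ell2_norm (a *: x) = `|a| * ell2_norm x.
Proof.
have sE : sqseries (a *: x) = a ^+ 2 *: sqseries x.
  apply/funext => n; rewrite fctE /sqseries /series /= scaler_sumr.
  by apply: eq_bigr => i _; rewrite fctE exprMn.
rewrite /ell2_norm sE limZr; last exact/square_summableP/ell2P.
by rewrite sqrtrM ?sqr_ge0// sqrtr_sqr.
Qed.

HB.instance Definition _ := Lmodule_isNormed.Build R ell2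
  ell2_norm_triangle ell2_normZ ell2_norm0_eq0.

Lemma ell2_normE x : `|x| = ell2_norm x.
Proof. by []. Qed.

End ell2.

Section quotient.
Variable R : realType.
Implicit Types x y z p q : ell2 R.

(* The permutation s sends x to the sequence whose entry at s k is x k.        *)
Definition perm_orbit x : set (ell2 R) :=
  [set y | exists2 s : nat -> nat, bijective s & forall k, y (s k) = x k].

Lemma perm_orbit_refl x : perm_orbit x x.
Proof. by exists id => //; exists id. Qed.

Lemma perm_orbit_sym x y : perm_orbit x y -> perm_orbit y x.
Proof.
move=> [s [t st ts] yx]; exists t; first by exists s.
by move=> k; rewrite -yx ts.
Qed.

Lemma perm_orbit_trans y x z :
  perm_orbit x y -> perm_orbit y z -> perm_orbit x z.
Proof.
move=> [s bs yx] [t bt zy]; exists (t \o s); first exact: bij_comp.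
by move=> k /=; rewrite zy yx.
Qed.

Lemma sqseries_inj (u : nat -> R) (t : nat -> nat) n : injective t ->
  exists m, sqseries (u \o t) n <= sqseries u m.
Proof.
move=> inj_t; exists (\max_(k < n) t k).+1.
set m := (X in sqseries u X).
have tm (k : 'I_n) : (t k < m)%N by rewrite ltnS; exact: leq_bigmax.
pose g (k : 'I_n) : 'I_m := Ordinal (tm k).
have inj_g : injective g by move=> i j [] /inj_t /val_inj.
rewrite /sqseries /series /= !big_mkord.
rewrite (_ : \sum_(i < n) _ = \sum_(j in g @: 'I_n) u j ^+ 2); last first.
  by rewrite big_imset//=; move=> i j _ _; exact: inj_g.
rewrite [leRHS](bigID (mem (g @: 'I_n)))/= lerDl.
by apply: sumr_ge0 => i _; exact: sqr_ge0.
Qed.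

Lemma norm_inj_le x y (t : nat -> nat) : injective t ->
  (forall k, y k = x (t k)) -> `|y| <= `|x|.
Proof.
move=> inj_t yx; apply: ell2_norm_le; first exact: normr_ge0.
move=> n; rewrite ell2_normE ell2_norm_sqr.
have -> : y = x \o t :> (nat -> R) by apply/funext.
have [m /le_trans] := sqseries_inj x n inj_t.
by apply; exact: sqseries_le_lim (ell2P x).
Qed.

Lemma norm_perm x y (s : nat -> nat) : bijective s ->
  (forall k, y (s k) = x k) -> `|y| = `|x|.
Proof.
move=> bs yx; apply/eqP; rewrite eq_le; apply/andP; split; last first.
  by apply: (norm_inj_le (bij_inj bs)) => k; rewrite yx.
case: bs => t st ts; apply: (norm_inj_le (can_inj ts)) => k.
by rewrite -yx ts.
Qed.

Lemma perm_summable x (s : nat -> nat) : bijective s ->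
  exists y, forall k, y (s k) = x k.
Proof.
move=> [t st ts].
have xt : x \o t \in square_summable.
  apply: (@bounded_square_summable _ _ (limn (sqseries x))) => n.
  have [m /le_trans] := sqseries_inj x n (can_inj ts).
  by apply; exact: sqseries_le_lim (ell2P x).
by exists (Ell2 xt) => k /=; rewrite st.
Qed.

Lemma perm_orbit_move x x' y : perm_orbit x x' ->
  exists2 y', perm_orbit y y' & `|x' - y'| = `|x - y|.
Proof.
move=> [s bs xx']; have [y' yy'] := perm_summable y bs.
exists y'; first by exists s.
by apply: (norm_perm bs) => k; rewrite !ell2B xx' yy'.
Qed.

Definition orbit_dists x y : set R :=
  [set `|p - q| | p in perm_orbit x & q in perm_orbit y].

Definition orbit_dist x y : R := inf (orbit_dists x y).

Lemma orbit_dists_has_inf x y : has_inf (orbit_dists x y).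
Proof.
split.
  exists `|x - y|; exists x; first exact: perm_orbit_refl.
  by exists y => //; exact: perm_orbit_refl.
by exists 0 => _ [p _ [q _ <-]].
Qed.

Lemma orbit_dist_ge0 x y : 0 <= orbit_dist x y.
Proof.
apply: lb_le_inf; first exact: (orbit_dists_has_inf x y).1.
by move=> _ [p _ [q _ <-]].
Qed.

Lemma orbit_dist_le x y p q :
  perm_orbit x p -> perm_orbit y q -> orbit_dist x y <= `|p - q|.
Proof.
move=> xp yq; apply: ge_inf; first exact: (orbit_dists_has_inf x y).2.
by exists p => //; exists q.
Qed.

Lemma orbit_dist_lt x y (e : R) : orbit_dist x y < e ->
  exists2 q, perm_orbit y q & `|x - q| < e.
Proof.
move=> /(inf_lt (orbit_dists_has_inf x y).1)[_ [p xp [q yq <-]] pqe].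
have [q' qq' E] := perm_orbit_move q (perm_orbit_sym xp).
by exists q'; [exact: perm_orbit_trans qq' | rewrite E].
Qed.

Lemma orbit_distxx x : orbit_dist x x = 0.
Proof.
apply/eqP; rewrite eq_le orbit_dist_ge0 andbT.
have := orbit_dist_le (perm_orbit_refl x) (perm_orbit_refl x).
by rewrite subrr normr0.
Qed.

Lemma orbit_dist_sym x y : orbit_dist x y = orbit_dist y x.
Proof.
congr inf; apply/seteqP; split => _ [p xp [q yq <-]];
  by exists q => //; exists p => //; rewrite distrC.
Qed.

Lemma orbit_dist_triangle y x z :
  orbit_dist x z <= orbit_dist x y + orbit_dist y z.
Proof.
apply/ler_addgt0Pl => e e0; rewrite leNgt; apply/negP => h.
have e2 : 0 < e / 2 by rewrite divr_gt0.
have [q yq xq] : exists2 q, perm_orbit y q & `|x - q| < orbit_dist x y + e / 2.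
  by apply: orbit_dist_lt; rewrite ltrDl.
have [r zr yr] : exists2 r, perm_orbit z r & `|y - r| < orbit_dist y z + e / 2.
  by apply: orbit_dist_lt; rewrite ltrDl.
have [r' rr' E] := perm_orbit_move r yq.
have := orbit_dist_le (perm_orbit_refl x) (perm_orbit_trans zr rr').
rewrite leNgt => /negP; apply; apply: le_lt_trans h.
rewrite -(subrKA q); apply: (le_trans (ler_normD _ _)).
by rewrite E; lra.
Qed.

Lemma ell2_closureP (A : set (ell2 R)) x :
  closure A x <-> forall e : R, 0 < e -> exists2 q, A q & `|x - q| < e.
Proof.
split=> [clA e e0|h B].
  have [q [Aq xq]] := clA _ (nbhsx_ballx x _ e0).
  by exists q => //; move: xq; rewrite -ball_normE.
move=> /nbhs_ballP[e /= e0 eB]; have [q Aq xq] := h _ e0.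
by exists q; split => //; apply: eB; rewrite -ball_normE.
Qed.

Lemma orbit_dist_eq0 x y :
  closure (perm_orbit x) = closure (perm_orbit y) <-> orbit_dist x y = 0.
Proof.
have sub u v : orbit_dist u v = 0 ->
    closure (perm_orbit u) `<=` closure (perm_orbit v).
  move=> uv0 p /ell2_closureP pu; apply/ell2_closureP => e e0.
  have e2 : 0 < e / 2 by rewrite divr_gt0.
  have [u' uu' pu'] := pu _ e2.
  have : orbit_dist u v < e / 2 by rewrite uv0.
  move=> /orbit_dist_lt[v' vv' uv'].
  have [v2 vv2 E] := perm_orbit_move v' uu'.
  exists v2; first exact: perm_orbit_trans vv2.
  rewrite -(subrKA u') (le_lt_trans (ler_normD _ _))// E.
  by rewrite [e]splitr ltrD.
split=> [xy|xy0]; last first.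
  by apply/seteqP; split; apply: sub => //; rewrite orbit_dist_sym.
have /ell2_closureP h : closure (perm_orbit y) x.
  by rewrite -xy; apply: subset_closure; exact: perm_orbit_refl.
apply/eqP; rewrite eq_le orbit_dist_ge0 andbT.
apply/ler_addgt0Pl => e e0; have [q yq /ltW xq] := h _ e0.
by rewrite addr0 (le_trans _ xq)// orbit_dist_le//; exact: perm_orbit_refl.
Qed.

Record ell2_quotient := Ell2Quotient {
  quotient_set :> set (ell2 R);
  quotient_setP : quotient_set \in range (fun x => closure (perm_orbit x))
}.

HB.instance Definition _ := [isSub for quotient_set].
HB.instance Definition _ := [Choice of ell2_quotient by <:].

Implicit Types a b c : ell2_quotient.

Definition orbit_class x : ell2_quotient :=
  Ell2Quotient (mem_set (imageT (fun x => closure (perm_orbit x)) x)).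

Lemma orbit_classP a : exists x, orbit_class x = a.
Proof.
have /set_mem[x _ xa] := quotient_setP a.
by exists x; exact: val_inj.
Qed.

Definition class_repr a : ell2 R := sval (cid (orbit_classP a)).

Lemma class_reprK a : orbit_class (class_repr a) = a.
Proof. exact: svalP (cid (orbit_classP a)). Qed.

Lemma eq_orbit_class x y :
  orbit_class x = orbit_class y <-> orbit_dist x y = 0.
Proof.
rewrite -orbit_dist_eq0; split=> [/(congr1 val)//|xy]; exact: val_inj.
Qed.

(* Independent of the representatives, by quotient_distE below. *)
Definition quotient_dist a b : R := orbit_dist (class_repr a) (class_repr b).

Lemma quotient_distE x y :
  quotient_dist (orbit_class x) (orbit_class y) = orbit_dist x y.
Proof.
have h u v w z : orbit_class u = orbit_class v ->
    orbit_class w = orbit_class z -> orbit_dist u w <= orbit_dist v z.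
  move=> /eq_orbit_class uv /eq_orbit_class wz.
  rewrite (le_trans (orbit_dist_triangle v _ _))// uv add0r.
  rewrite (le_trans (orbit_dist_triangle z _ _))//.
  by rewrite (orbit_dist_sym z) wz addr0.
by apply/eqP; rewrite eq_le; apply/andP; split; apply: h; rewrite class_reprK.
Qed.

Lemma quotient_distxx a : quotient_dist a a = 0.
Proof. exact: orbit_distxx. Qed.

Lemma quotient_dist_positivity a b : quotient_dist a b = 0 -> a = b.
Proof. by move=> /eq_orbit_class; rewrite !class_reprK. Qed.

Lemma quotient_dist_sym a b : quotient_dist a b = quotient_dist b a.
Proof. exact: orbit_dist_sym. Qed.

Lemma quotient_dist_triangle b a c :
  quotient_dist a c <= quotient_dist a b + quotient_dist b c.
Proof. exact: orbit_dist_triangle. Qed.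

HB.instance Definition _ := isMetric.Build R ell2_quotient
  quotient_distxx quotient_dist_positivity
  quotient_dist_sym quotient_dist_triangle.

Lemma mdist_orbit_class x y :
  mdist (orbit_class x) (orbit_class y) =
  inf [set `|p - q| | p in perm_orbit x & q in perm_orbit y].
Proof. exact: quotient_distE. Qed.

End quotient.

Section Phi.
Variable R : realType.

(* The n-th largest entry of z (n = 1, 2, ...), counted with multiplicity: the *)
(* largest t such that at least n entries of z are >= t. For z nonnegative and *)
(* square summable with fewer than n positive entries this is 0. The value at  *)
(* n = 0 is irrelevant.                                                        *)
Definition nth_largest (z : nat -> R) (n : nat) : R :=
  sup [set t | (`I_n #<= [set i | t <= z i])%card].

Definition Phi_entry (x : nat -> R) (n : nat) : R :=
  if odd n then - nth_largest x^\- n.+1./2 else nth_largest x^\+ n./2.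

End Phi.

Section distortion.
Variable R : realType.

Definition is_hilbert (H : completeNormedModType R) : Prop :=
  exists dot : {dot H for @idfun R}, forall u, dot u u = `|u| ^+ 2.

Definition hilbert_bilipschitz (X : metricType R) (c : R) : Prop :=
  exists (H : completeNormedModType R) (f : X -> H) (alpha : R),
    [/\ is_hilbert H, 0 < alpha & forall x x' : X,
      alpha * mdist x x' <= `|f x - f x'| <= c * alpha * mdist x x'].

(* The infimum is taken in [1, +oo]; the constraint 1 <= c only matters when X *)
(* has at most one point, cf. hilbert_bilipschitz_ge1.                         *)
Definition euclidean_distortion (X : metricType R) : \bar R :=
  ereal_inf [set c%:E | c in [set c | 1 <= c /\ hilbert_bilipschitz X c]].

Lemma hilbert_bilipschitz_ge1 (X : metricType R) (c : R) (x x' : X) :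
  x != x' -> hilbert_bilipschitz X c -> 1 <= c.
Proof.
rewrite -mdist_gt0 => xx' [H [f [alpha [_ a0 /(_ x x')/andP[lo hi]]]]].
have := le_trans lo hi.
by rewrite -mulrA -[leLHS]mul1r ler_pM2r// mulr_gt0.
Qed.

End distortion.

(* Main.v *)
(* Truncating x and y to their first N entries reduces everything to finite     *)
(* support, since nth_largest is 1-Lipschitz for the sup norm. For finite       *)
(* support Phi(x) is a rearrangement of x (each entry t contributes t^+ and     *)
(* -t^-, one of which is 0, and zeros are in unlimited supply), which gives     *)
(* d([x],[y]) <= |Phi(x) - Phi(y)|. Conversely, inserting the entries of one    *)
(* list at their sorted position opposite a sorted list never increases the     *)
(* sum of squared differences, and passing to positive and negative parts does  *)
(* not either, so Phi is nonexpansive; as Phi is constant on orbits, this gives *)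
(* the other inequality.                                                        *)

Require Import Defs.
From HB Require Import structures.
From mathcomp Require Import all_boot all_order all_algebra.
From mathcomp Require Import sesquilinear.
From mathcomp Require Import all_classical all_reals all_analysis.
From mathcomp Require Import ring lra zify.

Import Order.TTheory GRing.Theory Num.Theory.
Import numFieldNormedType.Exports.
Local Open Scope classical_set_scope.
Local Open Scope ring_scope.

(** * Rearrangement of finite lists *)

(** The distance formula splits into two inequalities. Since Phi is constant on orbits
    ([ell2_Phi_perm]), the bound of [|Phi x - Phi y|] by the orbit distance only needs Phi to be
    nonexpansive ([ell2_Phi_nonexpansive]). This is the rearrangement inequality [sqdist_sort2_le],
    applied to the positive and to the negative parts, together with [sqr_funrposneg_le]. For the
    reverse bound, a finitely supported sequence has its image under Phi in its own orbit
    ([Phi_entry_finite_perm]), so the distance of two such images is among the numbers whose infimum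
    defines the orbit distance. Truncations are dense and both sides are continuous, which gives
    [ell2_Phi_isometric] in general. The square summable sequences form a Hilbert space
    ([is_hilbert_ell2]), so Phi is an isometric embedding that attains distortion 1. *)

Section rearrangement.
Variable R : realDomainType.
Implicit Types (s t : seq R) (z : seq (R * R)).

Local Notation sqdist z := (\sum_(p <- z) (p.1 - p.2) ^+ 2).

(** When [b < c] and [a' <= a], the inequality (a - a')(c - b) >= 0 says that pairing [a] with [c]
    and [a'] with [b] costs no more than the crossed pairing. This exchange is the inductive
    step. *)
Lemma sqdist_merge1_le (a b : R) s t : sorted >=%R (a :: s) ->
  size s = size t ->
  sqdist (zip (a :: s) (merge >=%R [:: b] t)) <=
  (a - b) ^+ 2 + sqdist (zip s t).
Proof.
elim: t s a => [|c t IH] [|a' s] a // ss; first by rewrite big_cons.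
move=> [st].
have /= /andP[aa' {}ss] := ss.
have [cb|bc] := leP c b.
  by rewrite !big_cons.
have {}IH := IH s a' ss st.
rewrite big_cons/= big_cons/=.
apply: le_trans (_ : (a - c) ^+ 2 + ((a' - b) ^+ 2 + sqdist (zip s t)) <= _).
  by rewrite lerD2l.
by rewrite !addrA lerD2r; nra.
Qed.

(** Insertion sort of [t]: each insertion of a head into the sorted tail is paid for by
    [sqdist_merge1_le]. *)
Lemma sqdist_sort_le s t : sorted >=%R s -> size s = size t ->
  sqdist (zip s (sort >=%R t)) <= sqdist (zip s t).
Proof.
elim: s t => [|a s IH] [|b t] // ss; move=> [st].
have -> : sort >=%R (b :: t) = merge >=%R [:: b] (sort >=%R t).
  apply: (@sorted_eq _ >=%R) => //.
  - exact: ge_trans.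
  - exact: ge_anti.
  - exact: (sort_sorted (@ge_total _ R)).
  - apply: (merge_sorted (@ge_total _ R)) => //.
    exact: (sort_sorted (@ge_total _ R)).
  - by rewrite perm_sort perm_sym perm_merge/= perm_cons perm_sort.
apply: le_trans (sqdist_merge1_le _ _ _ _ ss _) _; first by rewrite size_sort.
by rewrite big_cons lerD2l IH//; exact: path_sorted ss.
Qed.

(** Sorting the pairs by first coordinate leaves the sum unchanged and reduces to a sorted first
    list. *)
Lemma sqdist_sort2_le s t : size s = size t ->
  sqdist (zip (sort >=%R s) (sort >=%R t)) <= sqdist (zip s t).
Proof.
move=> st; pose z := sort (relpre fst >=%R) (zip s t).
have pz : perm_eq z (zip s t) by rewrite perm_sort.
have s1 : sort >=%R s = unzip1 z.
  by rewrite /unzip1 -sort_map -/(unzip1 _) unzip1_zip ?st.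
have t2 : sort >=%R t = sort >=%R (unzip2 z).
  apply/(perm_sortP (@ge_total _ R) ge_trans ge_anti).
  by rewrite perm_sym (perm_trans (perm_map snd pz))// -/(unzip2 _) unzip2_zip ?st.
rewrite s1 t2 -(perm_big _ pz)/= -[in leRHS](zip_unzip z).
apply: sqdist_sort_le; last by rewrite !size_map.
rewrite -s1; exact: (sort_sorted (@ge_total _ R)).
Qed.

End rearrangement.

(** * The n-th largest entry *)

Section finite_support.
Variable R : realType.
Implicit Types (u v x y z w : nat -> R).

Lemma perm_eq_mkseq_bij u v (M : nat) :
  (forall k, (M <= k)%N -> u k = 0) -> (forall k, (M <= k)%N -> v k = 0) ->
  perm_eq (mkseq u M) (mkseq v M) ->
  exists2 s : nat -> nat, bijective s & forall k, v (s k) = u k.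
Proof.
move=> u0 v0 /(perm_iotaP 0)[Is]; rewrite size_mkseq => pI uI.
have sI : size Is = M by rewrite (perm_size pI) size_iota.
have memI k : (k \in Is) = (k < M)%N by rewrite (perm_mem pI) mem_iota.
have uniqI : uniq Is by rewrite (perm_uniq pI) iota_uniq.
have nthI k : (k < M)%N -> (nth k Is k < M)%N.
  by move=> kM; rewrite -memI mem_nth ?sI.
(* The default value [k] of [nth] makes this map the identity from [M] on. *)
exists (fun k => nth k Is k).
  exists (fun k => if (k < M)%N then index k Is else k) => k.
    have [kM|kM] := ltnP k M; first by rewrite nthI// index_uniq ?sI.
    by rewrite nth_default ?sI// ltnNge kM.
  have [kM|kM] := ltnP k M; last by rewrite nth_default ?sI.
  by rewrite (set_nth_default k) ?nth_index ?memI ?sI// -?sI ?index_mem ?memI// sI.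
move=> k; have [kM|kM] := ltnP k M.
  have := congr1 (nth 0 ^~ k) uI.
  rewrite nth_mkseq// (nth_map k) ?sI// => ->.
  by rewrite nth_mkseq// nthI.
by rewrite nth_default ?sI// u0// v0.
Qed.

Lemma perm_mkseq_double u (N : nat) : perm_eq (mkseq u N.*2)
  (mkseq (fun k => u k.*2) N ++ mkseq (fun k => u k.*2.+1) N).
Proof.
apply/permP => a; elim: N => // N;
rewrite doubleS !mkseqS -!cats1 !count_cat/= => ->.
by rewrite !addn0 -addnA addnACA.
Qed.

(** Of the two numbers t^+ and -t^- that an entry t contributes, one is t and the other is 0. *)
Lemma perm_mkseq_funrposneg x (N : nat) : perm_eq
  (mkseq x^\+ N ++ mkseq (fun k => - x^\- k) N) (mkseq x N ++ nseq N 0).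
Proof.
apply/permP => a; elim: N => // N.
rewrite !mkseqS -!cats1 !count_cat/= /funrpos /funrneg.
rewrite !addn0 addnACA => ->; rewrite -addnA -[RHS]addnA; congr addn.
rewrite [RHS]addnA [RHS]addnC; congr addn; have [x0|x0] := leP (x N) 0.
  by rewrite max_l ?oppr_ge0// opprK addnC.
by rewrite max_r ?oppr0// oppr_le0 ltW.
Qed.

Lemma mkseq_eventually0 x (M N : nat) : (forall k, (M <= k)%N -> x k = 0) ->
  mkseq x (M + N) = mkseq x M ++ nseq N 0.
Proof.
move=> x0; elim: N => [|N IH]; first by rewrite addn0 cats0.
by rewrite addnS mkseqS IH rcons_cat x0 ?leq_addr// -cats1 -(nseqD N 1) addn1.
Qed.

Lemma nth_largest_perm z w (s : nat -> nat) n : bijective s ->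
  (forall k, z (s k) = w k) -> nth_largest z n = nth_largest w n.
Proof.
move=> bs zw; congr (sup _); apply: eq_set => t.
rewrite (@card_le_eqr _ _ _ _ [set i | t <= w i])//.
rewrite [X in (X #= _)%card](_ : _ = s @` [set i | t <= w i]).
  by apply: inj_card_eq => i j _ _; exact: bij_inj.
have [s' ss' s's] := bs.
apply/seteqP; split => i /=; last by move=> [j tj <-]; rewrite zw.
by move=> ti; exists (s' i) => //; rewrite -zw s's.
Qed.

(** The superlevel sets of [v] are initial segments, so the thresholds in the supremum form the ray
    up to [v n]. *)
Lemma nth_largest_nonincreasing v n :
  {homo v : i j / (i <= j)%N >-> j <= i} -> nth_largest v n.+1 = v n.
Proof.
move=> vi; rewrite /nth_largest.
rewrite [X in sup X](_ : _ = `]-oo, v n]%classic); first by rewrite sup_itv.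
apply/seteqP; split => t /=; rewrite in_itv/=; last first.
  move=> tv; apply: subset_card_le => i /=; rewrite ltnS => /vi; exact: le_trans.
move=> h; rewrite leNgt; apply/negP => vt.
have /(card_le_trans h) : ([set i | t <= v i] #<= `I_n)%card.
  apply: subset_card_le => i /= tv; rewrite ltnNge; apply/negP => /vi.
  by move=> /(le_trans tv); rewrite leNgt vt.
by rewrite card_le_II ltnn.
Qed.

(** The entries being nonnegative, the sorted list padded with the default 0 is still nonincreasing,
    and it is a rearrangement of [z]. *)
Lemma nth_largest_sort z N n : (forall k, 0 <= z k) ->
  (forall k, (N <= k)%N -> z k = 0) ->
  nth_largest z n.+1 = nth 0 (sort >=%R (mkseq z N)) n.
Proof.
move=> z_ge0 z0; set s := sort _ _.
have ss : size s = N by rewrite size_sort size_mkseq.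
have s_ge0 k : 0 <= nth 0 s k.
  have [kN|Nk] := ltnP k (size s); last by rewrite nth_default.
  have : nth 0 s k \in s by exact: mem_nth.
  by rewrite mem_sort => /mapP[i _ ->].
have [|||p bp zp] := @perm_eq_mkseq_bij (nth 0 s) z N => //.
- by move=> k Nk; rewrite nth_default ?ss.
- by rewrite -[X in mkseq _ X]ss mkseq_nth perm_sort.
rewrite (nth_largest_perm _ _ _ _ bp zp) nth_largest_nonincreasing// => i j ij.
have [js|sj] := ltnP j (size s); last by rewrite (nth_default _ sj).
apply: (sorted_leq_nth ge_trans ge_refl) => //.
- exact: (sort_sorted (@ge_total _ R)).
- by rewrite inE (leq_ltn_trans ij).
Qed.

(** Guarantees that [nth_largest] is a genuine supremum rather than a default value. *)
Lemma has_sup_nth_largest z n (C : R) : (forall k, 0 <= z k) ->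
  (forall k, z k <= C) ->
  has_sup [set t | (`I_n.+1 #<= [set i | t <= z i])%card].
Proof.
move=> z0 zC; split; first by exists 0; apply: subset_card_le => i _; exact: z0.
exists C => t /=; rewrite leNgt => h; apply/negP => Ct.
suff /(card_le_trans h) : ([set i | (t <= z i)%R] #<= `I_0)%card.
  by rewrite card_le_II.
by apply: subset_card_le => i /= ti; have := le_trans ti (zC i); rewrite leNgt Ct.
Qed.

End finite_support.

(** * Phi on sequences of finite support *)

Section Phi_finite.
Variable R : realType.
Implicit Types (x y z w : nat -> R).

(** If [t] is an admissible threshold for [z], then [t - e] is one for [w]. *)
Lemma le_nth_largest z w n (C e : R) : (forall k, 0 <= z k) ->
  (forall k, 0 <= w k) -> (forall k, w k <= C) ->
  (forall k, z k <= w k + e) ->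
  nth_largest z n.+1 <= nth_largest w n.+1 + e.
Proof.
move=> z0 w0 wC zw.
have [zn _] : has_sup [set t | (`I_n.+1 #<= [set i | t <= z i])%card].
  apply: (@has_sup_nth_largest _ _ _ (C + e)) => // k.
  by rewrite (le_trans (zw k))// lerD2r.
apply: ge_sup => // t /= ht; rewrite -lerBlDr.
apply: ub_le_sup; first exact: (has_sup_nth_largest _ _ _ _ w0 wC).2.
apply: (card_le_trans ht); apply: subset_card_le => i /= ti.
by rewrite lerBlDr (le_trans ti).
Qed.

Lemma Phi_entry_odd x j : Phi_entry x j.*2.+1 = - nth_largest x^\- j.+1.
Proof. by rewrite /Phi_entry oddS odd_double/= doubleK. Qed.

Lemma Phi_entry_even x j : Phi_entry x j.*2.+2 = nth_largest x^\+ j.+1.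
Proof. by rewrite /Phi_entry /= negbK odd_double/= doubleK. Qed.

Lemma Phi_entry_perm x y (s : nat -> nat) n : bijective s ->
  (forall k, y (s k) = x k) -> Phi_entry y n = Phi_entry x n.
Proof.
move=> bs yx; rewrite /Phi_entry.
by congr (if _ then - _ else _); apply: (nth_largest_perm _ _ _ _ _ bs) => k;
  rewrite /funrpos /funrneg yx.
Qed.

Lemma Phi_entry_parity x k : Phi_entry x k.+1 =
  if odd k then nth_largest x^\+ k./2.+1 else - nth_largest x^\- k./2.+1.
Proof.
by rewrite -{1}[k]odd_double_half; case: (odd k);
  rewrite ?Phi_entry_odd ?Phi_entry_even.
Qed.

Lemma funrpos_eq0 x k : x k = 0 -> x^\+ k = 0.
Proof. by rewrite /funrpos => ->; rewrite maxxx. Qed.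

Lemma funrneg_eq0 x k : x k = 0 -> x^\- k = 0.
Proof. by rewrite /funrneg => ->; rewrite oppr0 maxxx. Qed.

(** The first [N.*2] entries of Phi are, up to order, the first [N] entries of [x] and [N] zeros;
    the tail of [x] supplies these zeros. *)
Lemma Phi_entry_finite_perm x (N : nat) : (forall k, (N <= k)%N -> x k = 0) ->
  exists2 s : nat -> nat, bijective s &
    forall k, Phi_entry x (s k).+1 = x k.
Proof.
move=> x0.
have p0 k : (N <= k)%N -> x^\+ k = 0 by move=> /x0; exact: funrpos_eq0.
have n0 k : (N <= k)%N -> x^\- k = 0 by move=> /x0; exact: funrneg_eq0.
set sp := sort >=%R (mkseq x^\+ N); set sn := sort >=%R (mkseq x^\- N).
have ssp : size sp = N by rewrite size_sort size_mkseq.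
have ssn : size sn = N by rewrite size_sort size_mkseq.
have PhiE k : Phi_entry x k.*2.+1 = - nth 0 sn k.
  by rewrite Phi_entry_odd (nth_largest_sort _ _ N)// => i; exact: funrneg_ge0.
have PhiO k : Phi_entry x k.*2.+2 = nth 0 sp k.
  by rewrite Phi_entry_even (nth_largest_sort _ _ N)// => i; exact: funrpos_ge0.
apply: (@perm_eq_mkseq_bij _ x (fun k => Phi_entry x k.+1) N.*2).
- by move=> k Nk; apply: x0; lia.
- move=> k Nk; have Nk2 : (N <= k./2)%N by rewrite -[N]doubleK half_leq.
  rewrite -[k]odd_double_half; case: (odd k); rewrite ?PhiO ?PhiE.
    by rewrite nth_default// ssp.
  by rewrite nth_default ?oppr0// ssn.
have negE : mkseq (fun k => - nth 0 sn k) N = map -%R sn.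
  by rewrite /mkseq (map_comp -%R) -/(mkseq _ N) -[in LHS]ssn mkseq_nth.
rewrite -addnn mkseq_eventually0// addnn perm_sym.
apply: perm_trans (perm_mkseq_double _ _ _) _.
rewrite (eq_mkseq PhiE) (eq_mkseq PhiO) negE -[in X in _ ++ X]ssp mkseq_nth.
rewrite perm_catC.
apply: perm_trans (perm_mkseq_funrposneg _ _ _); apply: perm_cat.
  by rewrite perm_sort.
by rewrite [in X in perm_eq _ X]/mkseq (map_comp -%R x^\-) perm_map// perm_sort.
Qed.

Lemma sum_sqdist_nth_largest z w N : (forall k, 0 <= z k) ->
  (forall k, 0 <= w k) -> (forall k, (N <= k)%N -> z k = 0) ->
  (forall k, (N <= k)%N -> w k = 0) ->
  \sum_(0 <= k < N) (nth_largest z k.+1 - nth_largest w k.+1) ^+ 2 <=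
  \sum_(0 <= k < N) (z k - w k) ^+ 2.
Proof.
move=> z_ge0 w_ge0 z0 w0.
have zipE (s t : seq R) : size s = N -> size t = N ->
    \sum_(p <- zip s t) (p.1 - p.2) ^+ 2 =
    \sum_(0 <= k < N) (nth 0 s k - nth 0 t k) ^+ 2.
  move=> sN tN; rewrite (big_nth (0, 0)) size_zip sN tN minnn.
  by apply: eq_bigr => i _; rewrite nth_zip ?sN.
have := @sqdist_sort2_le _ (mkseq z N) (mkseq w N).
rewrite !zipE ?size_sort ?size_mkseq// => /(_ erefl).
congr (_ <= _).
  by apply: eq_bigr => k _; rewrite !(nth_largest_sort _ _ N).
by rewrite !big_nat; apply: eq_bigr => k /andP[_ kN]; rewrite !nth_mkseq.
Qed.

Lemma sum_double (f : nat -> R) N :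
  \sum_(0 <= k < N.*2) f k = \sum_(0 <= k < N) (f k.*2.+1 + f k.*2).
Proof.
elim: N => [|N IH]; first by rewrite !big_geq.
rewrite doubleS 2?big_nat_recr//= IH [in RHS]big_nat_recr//=.
by rewrite -addrA [_ + f _.+1]addrC.
Qed.

(** The right side exceeds the left by twice x^+ y^- + x^- y^+, because x^+ x^- and y^+ y^-
    vanish. *)
Lemma sqr_funrposneg_le (x y : nat -> R) k :
  (x^\+ k - y^\+ k) ^+ 2 + (x^\- k - y^\- k) ^+ 2 <= (x k - y k) ^+ 2.
Proof.
have xE (z : nat -> R) : z^\+ k - z^\- k = z k /\ z^\+ k * z^\- k = 0.
  rewrite /funrpos /funrneg; have [z0|/ltW z0] := leP (z k) 0.
    by rewrite max_l ?oppr_ge0// mul0r sub0r opprK.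
  by rewrite max_r ?oppr_le0// mulr0 subr0.
have [<- xpn] := xE x; have [<- ypn] := xE y.
have := mulr_ge0 (funrpos_ge0 x k) (funrneg_ge0 y k).
have := mulr_ge0 (funrpos_ge0 y k) (funrneg_ge0 x k).
nra.
Qed.

Lemma sqdist_Phi_finite x y (N : nat) : (forall k, (N <= k)%N -> x k = 0) ->
  (forall k, (N <= k)%N -> y k = 0) ->
  \sum_(0 <= k < N.*2) (Phi_entry x k.+1 - Phi_entry y k.+1) ^+ 2 <=
  \sum_(0 <= k < N) (x k - y k) ^+ 2.
Proof.
move=> x0 y0; rewrite sum_double big_split/=.
rewrite (eq_bigr (fun k => (nth_largest x^\+ k.+1 - nth_largest y^\+ k.+1) ^+ 2));
  last by move=> k _; rewrite !Phi_entry_even.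
rewrite [X in _ + X](eq_bigr
    (fun k => (nth_largest x^\- k.+1 - nth_largest y^\- k.+1) ^+ 2)); last first.
  by move=> k _; rewrite !Phi_entry_odd -opprD sqrrN.
apply: le_trans (lerD (sum_sqdist_nth_largest _ _ _ _ _ _ _)
  (sum_sqdist_nth_largest _ _ _ _ _ _ _)) _.
- by move=> k; exact: funrpos_ge0.
- by move=> k; exact: funrpos_ge0.
- by move=> k /x0; exact: funrpos_eq0.
- by move=> k /y0; exact: funrpos_eq0.
- by move=> k; exact: funrneg_ge0.
- by move=> k; exact: funrneg_ge0.
- by move=> k /x0; exact: funrneg_eq0.
- by move=> k /y0; exact: funrneg_eq0.
rewrite -big_split/=; apply: ler_sum => k _; exact: sqr_funrposneg_le.
Qed.

End Phi_finite.

(** * Phi on square summable sequences *)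

Section Phi_ell2.
Variable R : realType.
Implicit Types x y : ell2 R.

Lemma sqseries_le_norm x n : sqseries x n <= `|x| ^+ 2.
Proof. by rewrite ell2_normE ell2_norm_sqr sqseries_le_lim// ell2P. Qed.

Lemma entry_le_norm x k : `|x k| <= `|x|.
Proof.
rewrite -(@ler_pXn2r _ 2)// ?nnegrE// real_normK ?num_real//.
apply: le_trans _ (sqseries_le_norm x k.+1).
by rewrite /sqseries /series/= big_nat_recr//= lerDr; exact: sqseries_ge0.
Qed.

Lemma nth_largest_funrpos_le x y n :
  nth_largest x^\+ n.+1 <= nth_largest y^\+ n.+1 + `|x - y|.
Proof.
apply: (@le_nth_largest _ _ _ _ `|y|); try by move=> k; exact: funrpos_ge0.
  move=> k; rewrite /funrpos ge_max normr_ge0 andbT.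
  exact: le_trans (ler_norm _) (entry_le_norm y k).
move=> k; rewrite /funrpos ge_max addr_ge0 ?le_max ?lexx ?orbT// andbT.
rewrite -lerBlDl (le_trans _ (entry_le_norm _ k))// ell2B.
by rewrite (le_trans _ (ler_norm _))// lerD2l lerN2 le_max lexx.
Qed.

Lemma nth_largest_funrneg_le x y n :
  nth_largest x^\- n.+1 <= nth_largest y^\- n.+1 + `|x - y|.
Proof.
have := nth_largest_funrpos_le (- x) (- y) n.
by rewrite -opprD normrN -!funrposN.
Qed.

Lemma Phi_entry_lipschitz x y n :
  `|Phi_entry x n.+1 - Phi_entry y n.+1| <= `|x - y|.
Proof.
rewrite !Phi_entry_parity; case: odd.
  by rewrite ler_distlC; have := nth_largest_funrpos_le x y n./2;
    have := nth_largest_funrpos_le y x n./2; rewrite (distrC y x); lra.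
by rewrite ler_distlC; have := nth_largest_funrneg_le x y n./2;
  have := nth_largest_funrneg_le y x n./2; rewrite (distrC y x); lra.
Qed.

(** * Approximation by truncations *)

Definition truncate (N : nat) (u : nat -> R) (k : nat) : R :=
  if (k < N)%N then u k else 0.

Lemma truncate_eq0 N u k : (N <= k)%N -> truncate N u k = 0.
Proof. by rewrite /truncate ltnNge => ->. Qed.

Lemma sqseries_truncate_le N u n : sqseries (truncate N u) n <= sqseries u N.
Proof.
have [nN|/ltnW Nn] := leqP n N.
  apply: le_trans _ (@sqseries_nd _ u _ _ nN); apply: ler_sum => k _.
  by rewrite /truncate; case: ifP => // _; rewrite expr0n sqr_ge0.
rewrite /sqseries /series/= (big_cat_nat _ Nn)//= [X in _ + X]big1_seq ?addr0.
  by apply: ler_sum => k _; rewrite /truncate; case: ifP => // _;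
    rewrite expr0n sqr_ge0.
move=> k; rewrite mem_index_iota => /andP[_ /andP[Nk _]].
by rewrite truncate_eq0// expr0n.
Qed.

Lemma truncate_square_summable N u : truncate N u \in square_summable.
Proof.
exact: (bounded_square_summable (sqseries_truncate_le N u)).
Qed.

Definition ell2_truncate N u : ell2 R := Ell2 (truncate_square_summable N u).

Lemma ell2_truncate_dist x N :
  `|x - ell2_truncate N x| ^+ 2 <= `|x| ^+ 2 - sqseries x N.
Proof.
rewrite [leLHS]ell2_norm_sqr; apply: limr_le.
  exact/square_summableP/ell2P.
apply: nearW => n; rewrite lerBrDr.
apply: le_trans _ (sqseries_le_norm x (maxn n N)).
pose r : ell2 R := x - ell2_truncate N x; rewrite -/r.
have /le_trans -> // : sqseries r n + sqseries x N <=
    sqseries r (maxn n N) + sqseries (ell2_truncate N x) (maxn n N).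
  apply: lerD; first exact: (@sqseries_nd _ _ _ _ (leq_maxl n N)).
  apply: le_trans _ (@sqseries_nd _ _ _ _ (leq_maxr n N)).
  rewrite le_eqVlt; apply/orP; left; apply/eqP.
  by rewrite /sqseries /series/= !big_nat; apply: eq_bigr => k /andP[_ kN];
    rewrite /truncate kN.
rewrite /sqseries /series/= -big_split/=; apply: ler_sum => k _.
rewrite -[X in X ^+ 2 + _]/(x k - truncate N x k) /truncate;
case: ifP => _; first by rewrite subrr expr0n add0r.
by rewrite subr0 expr0n addr0.
Qed.

Lemma cvg_ell2_truncate x : `|x - ell2_truncate N x| @[N --> \oo] --> 0.
Proof.
have h : Num.sqrt (`|x| ^+ 2 - sqseries x N) @[N --> \oo] --> 0.
  rewrite -(@sqrtr0 R) -(subrr (`|x| ^+ 2)).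
  apply: continuous_cvg; first exact: sqrt_continuous.
  apply: cvgB; first exact: cvg_cst.
  by rewrite ell2_normE ell2_norm_sqr; exact/square_summableP/ell2P.
apply: (squeeze_cvgr _ (cvg_cst 0) h); apply: nearW => N; rewrite normr_ge0/=.
by rewrite -[leLHS]normr_id -sqrtr_sqr ler_wsqrtr// ell2_truncate_dist.
Qed.

(** Phrased with partial sums because the image of Phi is not yet known to be square summable; the
    case [y = 0] will show that it is. *)
Lemma sqseries_Phi_le x y n :
  sqseries (fun k => Phi_entry x k.+1 - Phi_entry y k.+1) n <= `|x - y| ^+ 2.
Proof.
have entry_cvg (z : ell2 R) k : Phi_entry (ell2_truncate N z) k.+1 @[N --> \oo] -->
    Phi_entry z k.+1.
  apply/cvgrPdist_le => e e0; near=> N.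
  apply: le_trans (Phi_entry_lipschitz z (ell2_truncate N z) k) _.
  near: N; have := cvg_ell2_truncate z.
  move=> /cvgr0_norm_le /(_ e e0); apply: filterS => N.
  by rewrite normr_id.
(* For fixed [n] this is a finite sum, so entrywise convergence of the truncated images lets the
   bound pass to the limit. *)
apply: (@cvgr_to_le _ \oo _ R (fun N => sqseries (fun k =>
  Phi_entry (ell2_truncate N x) k.+1 - Phi_entry (ell2_truncate N y) k.+1) n)).
  rewrite /sqseries /series/=; apply: cvg_big => [|k _]; first exact: add_continuous.
  by rewrite expr2; apply: cvgM; apply: cvgB; exact: entry_cvg.
near=> N.
have nN : (n <= N.*2)%N.
  by rewrite -addnn (@leq_trans N) ?leq_addr//; near: N; exact: nbhs_infty_ge.
apply: le_trans (@sqseries_nd _ _ _ _ nN) _.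
apply: le_trans (sqdist_Phi_finite _ _ _ _ _ _) _; try exact: truncate_eq0.
apply: le_trans _ (sqseries_le_norm _ N).
rewrite /sqseries /series/= !big_nat; apply: ler_sum => k /andP[_ kN].
by rewrite /truncate kN.
Unshelve. all: by end_near. Qed.

Lemma Phi_entry0 n : Phi_entry (0 : ell2 R) n.+1 = 0.
Proof.
have nth0 (z : nat -> R) k : (forall i, z i = 0) -> nth_largest z k.+1 = 0.
  by move=> z0; rewrite nth_largest_nonincreasing// => i j _; rewrite !z0.
rewrite Phi_entry_parity !nth0 ?oppr0; first by case: ifP.
- by move=> k; apply: funrneg_eq0.
- by move=> k; apply: funrpos_eq0.
Qed.

Lemma Phi_entry_square_summable x :
  (fun k => Phi_entry x k.+1) \in square_summable.
Proof.
apply: (@bounded_square_summable _ _ (`|x| ^+ 2)) => n.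
have := sqseries_Phi_le x 0 n; rewrite subr0.
by congr (sqseries _ _ <= _); apply/funext => k; rewrite Phi_entry0 subr0.
Qed.

Definition ell2_Phi x : ell2 R := Ell2 (Phi_entry_square_summable x).

Lemma ell2_Phi_nonexpansive x y : `|ell2_Phi x - ell2_Phi y| <= `|x - y|.
Proof.
apply: ell2_norm_le; first exact: normr_ge0.
exact: sqseries_Phi_le.
Qed.

Lemma perm_orbit_Phi_truncate x N :
  perm_orbit (ell2_truncate N x) (ell2_Phi (ell2_truncate N x)).
Proof.
have [s bs sE] := @Phi_entry_finite_perm R (truncate N x) N (truncate_eq0 N x).
by exists s.
Qed.

Lemma ell2_Phi_perm x y : perm_orbit x y -> ell2_Phi y = ell2_Phi x.
Proof.
by move=> [s bs yx]; apply: ell2_eqP => k; exact: Phi_entry_perm bs yx.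
Qed.

Lemma ell2_Phi_isometric x y :
  `|ell2_Phi x - ell2_Phi y| = orbit_dist x y.
Proof.
apply/eqP; rewrite eq_le; apply/andP; split.
  apply: lb_le_inf; first exact: (orbit_dists_has_inf x y).1.
  move=> _ [p xp [q yq <-]].
  by rewrite -(ell2_Phi_perm _ _ xp) -(ell2_Phi_perm _ _ yq)
    ell2_Phi_nonexpansive.
pose xN N := ell2_truncate N x; pose yN N := ell2_truncate N y.
(* Each truncation error enters twice: once for replacing the sequence by its truncation in the
   orbit distance, once for doing so under Phi. *)
suff h N : orbit_dist x y <= `|ell2_Phi x - ell2_Phi y| +
    2 * (`|x - xN N| + `|y - yN N|).
  have c : `|ell2_Phi x - ell2_Phi y| + 2 * (`|x - xN N| + `|y - yN N|)
      @[N --> \oo] --> `|ell2_Phi x - ell2_Phi y|.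
    rewrite -[X in _ --> X]addr0; apply: cvgD; first exact: cvg_cst.
    rewrite -(mulr0 2) -(addr0 0); apply: cvgM; first exact: cvg_cst.
    by apply: cvgD; exact: cvg_ell2_truncate.
  by apply: (cvgr_to_ge c); apply: nearW.
have d1 (z w : ell2 R) : orbit_dist z w <= `|z - w|.
  by apply: orbit_dist_le; exact: perm_orbit_refl.
have d2 : orbit_dist (xN N) (yN N) <= `|ell2_Phi (xN N) - ell2_Phi (yN N)|.
  by apply: orbit_dist_le; exact: perm_orbit_Phi_truncate.
have d3 : `|ell2_Phi (xN N) - ell2_Phi (yN N)| <=
    (`|x - xN N| + `|ell2_Phi x - ell2_Phi y|) + `|y - yN N|.
  rewrite (le_trans (ler_distD (ell2_Phi y) _ _))//.
  rewrite lerD ?ell2_Phi_nonexpansive//.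
  rewrite (le_trans (ler_distD (ell2_Phi x) _ _))// lerD2r distrC.
  exact: ell2_Phi_nonexpansive.
apply: le_trans (orbit_dist_triangle (xN N) _ _) _.
apply: le_trans (lerD (d1 _ _) (orbit_dist_triangle (yN N) _ _)) _.
apply: le_trans (lerD (lexx _) (lerD (le_trans d2 d3) (d1 _ _))) _.
rewrite (distrC (yN N)).
rewrite le_eqVlt; apply/orP; left; apply/eqP; ring.
Qed.

End Phi_ell2.

(** * Hilbert space structure of the square summable sequences *)

Section hilbert.
Variable R : realType.
Implicit Types x y z : ell2 R.

(** * Completeness *)

Lemma cvg_entry_dist_le (F : set_system (ell2 R)) (l : nat -> R) x (e : R) n :
  ProperFilter F -> 0 <= e -> (forall k, (y : ell2 R) k @[y --> F] --> l k) ->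
  F (ball x e) -> sqseries (fun k => l k - x k) n <= e ^+ 2.
Proof.
move=> FF e0 Fl Fxe.
apply: (@cvgr_to_le _ F _ R (fun y : ell2 R => sqseries (fun k => y k - x k) n)).
  rewrite /sqseries /series/=; apply: cvg_big => [|k _]; first exact: add_continuous.
  by rewrite expr2; apply: cvgM; (apply: cvgB; [exact: Fl|exact: cvg_cst]).
apply: filterS Fxe => y; rewrite -ball_normE/= => /ltW xye.
apply: le_trans (sqseries_le_norm _ (y - x) n) _.
by rewrite ler_sqr ?nnegrE// distrC.
Qed.

Lemma ell2_cauchy_cvg (F : set_system (ell2 R)) :
  ProperFilter F -> cauchy F -> cvg F.
Proof.
move=> FF /cauchyP cF.
have cvgk k : cvg ((y : ell2 R) k @[y --> F]).
  apply: cauchy_cvg; apply: cauchy_exP => e e0.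
  have [x Fx] := cF e e0; exists (x k).
  apply: (@filterS _ F _ (ball x e) _ _ Fx) => y.
  rewrite -!ball_normE/=; apply: le_lt_trans.
  exact: (entry_le_norm _ (x - y)).
pose l k := lim ((y : ell2 R) k @[y --> F]).
have [x1 Fx1] := cF 1 ltr01.
(* The entrywise limit [l] is square summable because it differs from [x1] by a sequence whose
   partial sums are at most the squared radius 1. *)
have lx1 : (fun k => l k - x1 k) \in square_summable.
  apply: (@bounded_square_summable _ _ (1 ^+ 2)) => n.
  exact: cvg_entry_dist_le Fx1.
pose L := Ell2 lx1 + x1.
have LE k : L k = l k by rewrite -[LHS]/(l k - x1 k + x1 k) subrK.
apply/cvg_ex; exists L; apply/cvg_ballP => e e0.
have e2 : 0 < e / 2 by rewrite divr_gt0.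
have [x Fx] := cF _ e2.
have Lx : `|L - x| <= e / 2.
  apply: ell2_norm_le; first exact: ltW.
  move=> n; have := cvg_entry_dist_le F l x _ n FF (ltW e2) cvgk Fx.
  by congr (sqseries _ _ <= _); apply/funext => k; rewrite -LE.
apply: filterS Fx => y; rewrite -!ball_normE/= => xy.
rewrite -(subrKA x) (le_lt_trans (ler_normD _ _))// [e]splitr.
exact: ler_ltD.
Qed.

HB.instance Definition _ := Uniform_isComplete.Build (ell2 R) ell2_cauchy_cvg.

(* Polarization makes the convergence of the series of products immediate. *)
Definition ell2_dot x y : R := (`|x + y| ^+ 2 - `|x| ^+ 2 - `|y| ^+ 2) / 2.

Lemma cvg_sqseries x : sqseries x @ \oo --> `|x| ^+ 2.
Proof. by rewrite ell2_normE ell2_norm_sqr; exact/square_summableP/ell2P. Qed.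

(** Bilinearity is hidden in the polarization formula; this series lets it be read off termwise, by
    uniqueness of limits. *)
Lemma cvg_ell2_dot x y :
  series (fun k => x k * y k) @ \oo --> ell2_dot x y.
Proof.
rewrite [X in X @ _](_ : _ = fun n =>
    (sqseries (x + y : ell2 R) n - sqseries x n - sqseries y n) / 2); last first.
  apply/funext => n; rewrite /sqseries /series/= -!sumrB mulr_suml.
  by apply: eq_bigr => k _; rewrite -[X in X ^+ 2 - _ - _]/(x k + y k); field.
apply: cvgM; last exact: cvg_cst.
by apply: cvgB; [apply: cvgB|]; exact: cvg_sqseries.
Qed.

Lemma ell2_dotC x y : ell2_dot x y = ell2_dot y x.
Proof. by rewrite /ell2_dot (addrC x) addrAC. Qed.

Lemma ell2_dotxx x : ell2_dot x x = `|x| ^+ 2.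
Proof. by rewrite /ell2_dot -mulr2n -scaler_nat normrZ normr_nat; field. Qed.

Lemma ell2_dotBl z : zmod_morphism (ell2_dot ^~ z).
Proof.
move=> x y; apply: (cvg_unique (@norm_hausdorff _ R) (cvg_ell2_dot _ _)).
rewrite [X in X @ _](_ : _ = series (fun k => x k * z k) \-
    series (fun k => y k * z k)); last first.
  apply/funext => n; rewrite /series/= -sumrB.
  by apply: eq_bigr => k _; exact: mulrBl.
by apply: cvgB; exact: cvg_ell2_dot.
Qed.

Lemma ell2_dotZl z : scalable_for *%R (ell2_dot ^~ z).
Proof.
move=> a x; apply: (cvg_unique (@norm_hausdorff _ R) (cvg_ell2_dot _ _)).
rewrite [X in X @ _](_ : _ = fun n => a * series (fun k => x k * z k) n).
  by apply: cvgM; [exact: cvg_cst|exact: cvg_ell2_dot].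
apply/funext => n; rewrite /series/= mulr_sumr.
by apply: eq_bigr => k _; exact/esym/mulrA.
Qed.

Lemma ell2_dotBr x : zmod_morphism (ell2_dot x).
Proof. by move=> y z; rewrite !(ell2_dotC x); exact: ell2_dotBl. Qed.

Lemma ell2_dotZr x : scalable_for (@idfun R \; *%R) (ell2_dot x).
Proof. by move=> a y; rewrite !(ell2_dotC x); exact: ell2_dotZl. Qed.

HB.instance Definition _ := isBilinear.Build R (ell2 R) (ell2 R) R
  *%R (@idfun R \; *%R) ell2_dot ell2_dotBl ell2_dotBr ell2_dotZl ell2_dotZr.

Lemma ell2_dot_hermitian x y :
  ell2_dot x y = (-1) ^+ false * @idfun R (ell2_dot y x).
Proof. by rewrite expr0 mul1r ell2_dotC. Qed.

HB.instance Definition _ := isHermitianSesquilinear.Build R (ell2 R) false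
  (@idfun R) ell2_dot ell2_dot_hermitian.

Lemma ell2_dot_gt0 x : x != 0 -> 0 < ell2_dot x x.
Proof. by move=> x0; rewrite ell2_dotxx exprn_gt0// normr_gt0. Qed.

HB.instance Definition _ := isDotProduct.Build R (ell2 R) ell2_dot ell2_dot_gt0.

Lemma is_hilbert_ell2 : is_hilbert (ell2 R : completeNormedModType R).
Proof.
exists (ell2_dot : {dot (ell2 R) for (@idfun R)}) => u; exact: ell2_dotxx.
Qed.

End hilbert.

(** The chosen representative may lie outside the orbit of [x], but it is at orbit distance 0, so
    the isometry identifies the images. *)
Lemma ell2_Phi_class_repr (R : realType) (x : ell2 R) :
  ell2_Phi R (class_repr (orbit_class x)) = ell2_Phi R x.
Proof.
apply/eqP; rewrite -subr_eq0 -normr_eq0 ell2_Phi_isometric.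
by apply/eqP/eq_orbit_class; exact: class_reprK.
Qed.

Theorem theorem41 (R : realType) :
  (exists2 Phi : ell2_quotient R -> ell2 R,
     forall (x : ell2 R) (k : nat),
       Phi (orbit_class x) k = Phi_entry x k.+1 &
     forall x y : ell2 R,
       `|Phi (orbit_class x) - Phi (orbit_class y)|
         = mdist (orbit_class x) (orbit_class y)) /\
  euclidean_distortion (ell2_quotient R) = 1%:E.
Proof.
have isom x y : `|ell2_Phi R (class_repr (orbit_class x)) -
    ell2_Phi R (class_repr (orbit_class y))| =
    mdist (orbit_class x) (orbit_class y).
  by rewrite !ell2_Phi_class_repr ell2_Phi_isometric mdist_orbit_class.
split.
  exists (fun a => ell2_Phi R (class_repr a)) => // x k.
  by rewrite ell2_Phi_class_repr.
apply/eqP; rewrite eq_le; apply/andP; split; last first.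
  (* The lower bound is the constraint [1 <= c] built into the infimum. *)
  by apply: le_ereal_inf_tmp => _ [c [c1 _] <-]; rewrite lee_fin.
apply: ereal_inf_lbound; exists 1 => //; split=> //.
exists (ell2 R : completeNormedModType R),
  (fun a => ell2_Phi R (class_repr a)), 1; split=> //.
  exact: is_hilbert_ell2.
by move=> a b; rewrite !mul1r -(class_reprK a) -(class_reprK b) isom lexx.
Qed.
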